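(* Let $G$ and $H$ be finitely generated residually nilpotent groups such that $\tau=\tau(G)$ is finite. Suppose that $\phi:G\to H$ is a lower central $\tau$-monomorphism. Let $k\ge 1$ be an integer, let $\pi\subseteq\tau$, and let $N=I_\pi(\gamma_k(H))$ (the $\pi$-isolator in $H$) and $M=I_\pi(\gamma_k(G))$ (the $\pi$-isolator in $G$). If $\tau(G/Z_j(M))\subseteq\tau$ for some $j\ge1$, then $H/Z_j(N)$ is para-$(G/Z_j(M))$. Furthermore, if $G/Z_j(M)\not\cong H/Z_j(N)$, then $G\not\cong H$.
   Context: For a group $G$, $\gamma_1(G)=G$, $\gamma_{i+1}(G)=[\gamma_i(G),G]$ is the lower central series, $G_{ab}=G/\gamma_2(G)$, and $Z_0(G)=1\le Z_1(G)=Z(G)\le Z_2(G)\le\cdots$ is the upper central series. A group is residually nilpotent if $\bigcap_{i}\gamma_i(G)=1$. For a group $K$ and $n\in\mathbb{N}$, $K^n$ is the subgroup generated by all $n$-th powers of elements of $K$. For $n\in\mathbb{N}$ (positive), $\pi(n)$ is the set of primes dividing $n$. For a set of primes $\pi$, $\pi'$ is its complement in the set of all primes; $n$ is a $\pi$-number if $\pi(n)\subseteq\pi$ and a $\pi'$-number if $\pi(n)\subseteq\pi'$. If $K\le G$, the $\pi$-isolator of $K$ in $G$ is $I_\pi(K)=\langle x\in G\mid x^n\in K \text{ for some } \pi\text{-number } n\rangle$. For a finitely generated group $G$, $\tau(G)=\bigcup_{i=1}^\infty \pi\big(|\mathrm{Tor}(\gamma_i(G)/\gamma_{i+1}(G))|\big)$,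 where $\mathrm{Tor}$ denotes the torsion subgroup (finite here). Lower central $\tau$-monomorphism (with $\tau=\tau(G)$): a monomorphism $\phi:G\to H$ which induces an isomorphism $G_{ab}\cong H_{ab}$ and for which there exist $\tau'$-numbers $n_i$ such that $\gamma_i(H)^{n_i}\le\phi(\gamma_i(G))$ for all $i\ge2$. $H$ is para-$G$ if there is a monomorphism $\phi:G\to H$ such that the induced map $G/\gamma_i(G)\to H/\gamma_i(H)$ is an isomorphism for every $i$. *)

(* Defs.v *)
From HB Require Import structures.
From mathcomp Require Import all_boot.
From mathcomp Require Import boolp classical_sets functions cardinality.

Set Implicit Arguments.
Unset Strict Implicit.
Unset Printing Implicit Defensive.

Local Open Scope classical_set_scope.
Local Open Scope group_scope.
Local Open Scope quotient_scope.

Section Subgroups.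
Variable G : groupType.
Implicit Types A B : set G.

Record is_subgroup A : Prop := IsSubgroup {
  subg1 : A 1;
  subgM : forall x y, A x -> A y -> A (x * y);
  subgV : forall x, A x -> A x^-1
}.

Definition conj_closed A : Prop := forall x y, A x -> A (x ^ y).

Record normal := Normal {
  normal_set :> set G;
  normal_subg : is_subgroup normal_set;
  normalJ : conj_closed normal_set
}.

Definition gen A : set G := smallest is_subgroup A.

Definition commgroup A B : set G :=
  gen [set z | exists x y, [/\ A x, B y & z = [~ x, y]]].

(* K^n *)
Definition powgroup (K : set G) (n : nat) : set G :=
  gen [set x ^+ n | x in K].

Lemma gen_subg A : is_subgroup (gen A).
Proof.
split.
- by move=> K [sK _]; exact: subg1 sK.
- by move=> x y gx gy K [sK AK]; apply: (subgM sK); [apply: gx | apply: gy].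
- by move=> x gx K [sK AK]; apply: (subgV sK); apply: gx.
Qed.

Lemma sub_genset A : A `<=` gen A.
Proof. by move=> x Ax K [_]; exact. Qed.

Lemma gen_conj A : conj_closed A -> conj_closed (gen A).
Proof.
move=> cA x y gx.
apply: (gx [set z | gen A (z ^ y)]); split; last first.
  by move=> z Az; apply: sub_genset; exact: cA.
have sA := gen_subg A; split => /=.
- by rewrite conj1g; exact: subg1 sA.
- by move=> u v gu gv; rewrite conjMg; exact: subgM sA _ _ gu gv.
- by move=> u gu; rewrite conjVg; exact: subgV sA _ gu.
Qed.

Lemma setT_subg : is_subgroup [set: G].
Proof. by split. Qed.

Definition setT_normal : normal := @Normal setT setT_subg (fun _ _ _ => I).

Lemma commgroup_conj A B : conj_closed A -> conj_closed B ->
  conj_closed (commgroup A B).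
Proof.
move=> cA cB; apply: gen_conj => z t [x [y [Ax By ->]]].
by exists (x ^ t), (y ^ t); split; [exact: cA | exact: cB | rewrite conjRg].
Qed.

Definition commgroup_normal (M N : normal) : normal :=
  Normal (gen_subg _) (commgroup_conj (@normalJ M) (@normalJ N)).

(* gamma_i(G) for i >= 1; i = 0 is not a meaningful index and also gives G *)
Definition lcs (i : nat) : normal :=
  iter i.-1 (fun K => commgroup_normal K setT_normal) setT_normal.

(* Z_j(M); Z_(j+1)(M) / Z_j(M) is the centre of M / Z_j(M) *)
Fixpoint ucs (M : set G) (j : nat) : set G :=
  if j is j'.+1 then [set x | M x /\ forall y, M y -> ucs M j' [~ x, y]]
  else [set 1].

Lemma commMgJ (x y z : G) : [~ x * y, z] = [~ x, z] ^ y * [~ y, z].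
Proof. by rewrite /commg /conjg !invgM !mulgA !gnorm. Qed.

Lemma commVgJ (x z : G) : [~ x^-1, z] = ([~ x, z] ^ x^-1)^-1.
Proof.
apply: esym; apply: mulg1_eq.
by rewrite -commMgJ mulgV comm1g.
Qed.

Lemma ucs_conj (M : normal) j : conj_closed (ucs M j).
Proof.
elim: j => [|j IH] x y /=; first by move=> ->; exact: conj1g.
move=> [Mx Zx]; split; first exact: normalJ.
move=> z Mz; rewrite -(conjgKV y z) -conjRg.
by apply: IH; apply: Zx; exact: normalJ.
Qed.

Lemma ucs_subg (M : normal) j : is_subgroup (ucs M j).
Proof.
elim: j => [|j IH] /=.
  by split=> // [x y -> ->|x ->]; rewrite ?mulg1 ?invg1.
have sM := normal_subg M; split.
- split; first exact: subg1 sM.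
  by move=> y _; rewrite comm1g; exact: subg1 IH.
- move=> x y [Mx Zx] [My Zy]; split; first exact: subgM sM _ _ Mx My.
  move=> z Mz; rewrite commMgJ; apply: (subgM IH); last exact: Zy.
  by apply: ucs_conj; exact: Zx.
- move=> x [Mx Zx]; split; first exact: subgV sM _ Mx.
  move=> z Mz; rewrite commVgJ; apply: (subgV IH).
  by apply: ucs_conj; exact: Zx.
Qed.

Definition ucs_normal (M : normal) (j : nat) : normal :=
  Normal (ucs_subg M j) (@ucs_conj M j).

End Subgroups.

Arguments lcs : clear implicits.

Definition pi_number (pi : set nat) (n : nat) : Prop :=
  (0 < n)%N /\ [set p | p \in \pi(n)] `<=` pi.

Definition prime_compl (pi : set nat) : set nat :=
  [set p | prime p] `\` pi.

Section Isolator.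
Variables (G : groupType) (pi : set nat).

Definition isolator (K : set G) : set G :=
  gen [set x | exists n, pi_number pi n /\ K (x ^+ n)].

Lemma isolator_conj (K : normal G) : conj_closed (isolator K).
Proof.
apply: gen_conj => x y [n [pin Kx]]; exists n; split=> //.
by rewrite -conjXg; exact: normalJ.
Qed.

Definition isolator_normal (K : normal G) : normal G :=
  Normal (gen_subg _) (@isolator_conj K).

End Isolator.

Section Quotient.
Variables (G : groupType) (N : normal G).
Let sN := normal_subg N.

Definition coset_rel : rel G := fun x y => `[< normal_set N (x^-1 * y) >].

Lemma coset_rel_refl : reflexive coset_rel.
Proof. by move=> x; apply/asboolP; rewrite mulVg; exact: subg1 sN. Qed.

Lemma coset_rel_sym : symmetric coset_rel.
Proof.
have h x y : coset_rel x y -> coset_rel y x.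
  by move=> /asboolP /(subgV sN); rewrite invgM invgK => ?; apply/asboolP.
by move=> x y; apply/idP/idP; exact: h.
Qed.

Lemma coset_rel_trans : transitive coset_rel.
Proof.
move=> y x z /asboolP xy /asboolP yz; apply/asboolP.
by have := subgM sN xy yz; rewrite mulgA mulgK.
Qed.

Canonical coset_equiv :=
  EquivRel coset_rel coset_rel_refl coset_rel_sym coset_rel_trans.

(* the quotient group G / N *)
Definition quot : Type := {eq_quot coset_equiv}.

HB.instance Definition _ := Choice.on quot.
HB.instance Definition _ := EqQuotient.on quot.

Lemma eq_quotP (x y : G) : (\pi_quot x = \pi_quot y) <-> normal_set N (x^-1 * y).
Proof.
split; first by move=> /eqP; rewrite eqmodE => /asboolP.
by move=> h; apply/eqP; rewrite eqmodE; exact/asboolP.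
Qed.

Definition quot_mul (u v : quot) : quot := \pi_quot (repr u * repr v).
Definition quot_one : quot := \pi_quot 1.
Definition quot_inv (u : quot) : quot := \pi_quot (repr u)^-1.

Lemma quot_mulE x y : quot_mul (\pi_quot x) (\pi_quot y) = \pi_quot (x * y).
Proof.
apply/eq_quotP; set x' := repr _; set y' := repr _.
have hx : normal_set N (x'^-1 * x) by apply/eq_quotP; rewrite reprK.
have hy : normal_set N (y'^-1 * y) by apply/eq_quotP; rewrite reprK.
have -> : (x' * y')^-1 * (x * y) = (x'^-1 * x) ^ y' * (y'^-1 * y).
  by rewrite /conjg invgM !mulgA !gnorm.
by apply: (subgM sN) => //; exact: normalJ.
Qed.

Lemma quot_invE x : quot_inv (\pi_quot x) = \pi_quot x^-1.
Proof.
apply/eq_quotP; set x' := repr _; rewrite invgK.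
have hx : normal_set N (x^-1 * x') by apply/eq_quotP; rewrite reprK.
have -> : x' * x^-1 = (x^-1 * x') ^ x^-1.
  by rewrite /conjg invgK !mulgA mulgV mul1g.
exact: normalJ.
Qed.

Lemma quot_mulA : associative quot_mul.
Proof.
move=> u v w; rewrite -(reprK u) -(reprK v) -(reprK w).
by rewrite (quot_mulE (repr v)) (quot_mulE (repr u) (repr v)) !quot_mulE mulgA.
Qed.

Lemma quot_mul1 : left_id quot_one quot_mul.
Proof. by move=> u; rewrite -(reprK u) quot_mulE mul1g. Qed.

Lemma quot_mulr1 : right_id quot_one quot_mul.
Proof. by move=> u; rewrite -(reprK u) quot_mulE mulg1. Qed.

Lemma quot_mulV : left_inverse quot_one quot_inv quot_mul.
Proof. by move=> u; rewrite -(reprK u) quot_invE quot_mulE mulVg. Qed.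

Lemma quot_mulrV : right_inverse quot_one quot_inv quot_mul.
Proof. by move=> u; rewrite -(reprK u) quot_invE quot_mulE mulgV. Qed.

HB.instance Definition _ := isGroup.Build quot
  quot_mulA quot_mul1 quot_mulr1 quot_mulV quot_mulrV.

Definition quot_pi (x : G) : quot := \pi_quot x.

Lemma quot_piM : {morph quot_pi : x y / x * y}.
Proof. by move=> x y; rewrite /quot_pi -quot_mulE. Qed.

HB.instance Definition _ := isMultiplicative.Build G quot quot_pi quot_piM.

End Quotient.

Definition finitely_generated (G : groupType) : Prop :=
  exists A : set G, finite_set A /\ gen A = setT.

Definition residually_nilpotent (G : groupType) : Prop :=
  \bigcap_(i in [set i | (1 <= i)%N]) lcs G i = [set 1].

Definition torsion (G : groupType) (A : set G) : set G :=
  [set x | A x /\ exists n, (0 < n)%N /\ x ^+ n = 1].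

(* pi(|A|) for a finite set A *)
Definition card_primes (T : Type) (A : set T) : set nat :=
  [set p | exists n, (A #= `I_n)%card /\ p \in \pi(n)].

(* gamma_i(G) / gamma_(i+1)(G), as a subset of G / gamma_(i+1)(G) *)
Definition lcs_factor (G : groupType) (i : nat) : set (quot (lcs G i.+1)) :=
  @quot_pi G (lcs G i.+1) @` lcs G i.
Arguments lcs_factor : clear implicits.

Definition tau (G : groupType) : set nat :=
  \bigcup_(i in [set i | (1 <= i)%N]) card_primes (torsion (lcs_factor G i)).

Definition isomorphic (G H : groupType) : Prop :=
  exists f : {multiplicative G -> H}, bijective f.

Definition induces_iso (G H : groupType) (phi : G -> H)
    (N : normal G) (K : normal H) : Prop :=
  exists f : {multiplicative (quot N) -> (quot K)},
    bijective f /\ forall x, f (quot_pi N x) = quot_pi K (phi x).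

Definition lower_central_mono (t : set nat) (G H : groupType)
    (phi : {multiplicative G -> H}) : Prop :=
  [/\ injective phi,
      induces_iso phi (lcs G 2) (lcs H 2) &
      exists n : nat -> nat, forall i, (2 <= i)%N ->
        pi_number (prime_compl t) (n i) /\
        powgroup (lcs H i) (n i) `<=` phi @` lcs G i].

(* H is para-G *)
Definition para (G H : groupType) : Prop :=
  exists phi : {multiplicative G -> H}, injective phi /\
    forall i, (1 <= i)%N -> induces_iso phi (lcs G i) (lcs H i).

(* Main.v *)
(** Since [H = phi(G) gamma_2(H)], induction gives [H = phi(G) gamma_i(H)] for
    all [i].  If [phi x] is in [gamma_(i+1)(H)] and [x] in [gamma_i(G)], then a
    tau'-power of [x] lies in [gamma_(i+1)(G)]; as the torsion of
    [gamma_i(G)/gamma_(i+1)(G)] is a finite tau-group, [x] itself lies there.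
    So a lower central tau-monomorphism induces isomorphisms
    [G/gamma_i(G) = H/gamma_i(H)] for all [i].

    Hence [M] is the preimage of [N], and since residual nilpotence makes
    [Z_j(N)] closed for the topology defined by the [gamma_l(H)], [Z_j(M)] is
    the preimage of [Z_j(N)].  Every [z] in [N] is [phi x * h] with [h] in
    [gamma_i(H)] inside [N], so a tau'-power of [h] is in [phi(G)]; descending
    the upper central series shows that each [z] in [Z_j(N)] has a tau'-power in
    [phi(G)].  Therefore an element of [G/Z_j(M)] which becomes trivial in the
    abelianization of [H/Z_j(N)] is tau'-torsion in that of [G/Z_j(M)], hence
    trivial since [tau(G/Z_j(M))] is contained in [tau].  The induced map
    [G/Z_j(M) -> H/Z_j(N)] is thus again a lower central tau-monomorphism, and
    the first paragraph applies to it. *)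

From HB Require Import structures.
From mathcomp Require Import all_boot fingroup perm cyclic.
From mathcomp Require Import boolp classical_sets functions cardinality.
(* [Defs] comes last so that [normal] is not the one of [fingroup]. *)
Require Import Defs.

Set Implicit Arguments.
Unset Strict Implicit.
Unset Printing Implicit Defensive.

Local Open Scope classical_set_scope.
Local Open Scope group_scope.

(** * Morphisms, generated subgroups, congruences and the two central series *)

Section GroupMorphisms.
Variables (G H : groupType) (f : {multiplicative G -> H}).

Lemma multf1 : f 1 = 1.
Proof. by apply: (mulgI (f 1)); rewrite -gmulfM !mulg1. Qed.

Lemma multfV : {morph f : x / x^-1}.
Proof. by move=> x; apply/esym/mulg1_eq; rewrite -gmulfM mulgV multf1. Qed.

Lemma multfX n : {morph f : x / x ^+ n}.
Proof.
by move=> x; elim: n => [|n IHn]; rewrite ?expg0 ?multf1 // !expgS gmulfM IHn.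
Qed.

Lemma multfR : {morph f : x y / [~ x, y]}.
Proof. by move=> x y; rewrite /commg /conjg !gmulfM !multfV. Qed.

End GroupMorphisms.

Section Subgroups.
Variable G : groupType.
Implicit Types (A B : set G) (K : normal G).

Lemma gen_sub A B : is_subgroup B -> A `<=` B -> gen A `<=` B.
Proof. by move=> sB AB x; apply. Qed.

Lemma genS A B : A `<=` B -> gen A `<=` gen B.
Proof.
by move=> AB; apply: gen_sub (gen_subg B) _ => x /AB; exact: sub_genset.
Qed.

Lemma subgX A x n : is_subgroup A -> A x -> A (x ^+ n).
Proof.
move=> sA Ax; elim: n => [|n IHn]; first by rewrite expg0; exact: subg1.
by rewrite expgS; exact: subgM.
Qed.

(** The set is the product [A K]. Inclusion of a generated subgroup in such a product can then be
    checked on generators. *)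
Lemma mulset_subg A K : is_subgroup A ->
  is_subgroup [set y | exists2 x, A x & normal_set K (x^-1 * y)].
Proof.
have sK := normal_subg K.
move=> sA; split => /=.
- by exists 1; rewrite ?invg1 ?mulg1; exact: subg1.
- move=> y y' [x Ax Kx] [x' Ax' Kx']; exists (x * x'); first exact: subgM.
  have -> : (x * x')^-1 * (y * y') = (x^-1 * y) ^ x' * (x'^-1 * y').
    by rewrite /conjg invgM !mulgA !gnorm.
  by apply: subgM => //; exact: normalJ.
- move=> y [x Ax Kx]; exists x^-1; first exact: subgV.
  have -> : x^-1^-1 * y^-1 = ((x^-1 * y) ^ x^-1)^-1.
    by rewrite /conjg !invgM !invgK !mulgA !gnorm.
  by apply: subgV => //; exact: normalJ.
Qed.

(** This is the preimage of the centralizer of [y] modulo [K], so commutators modulo [K] need only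
    be checked on generators. *)
Lemma comm_in_subg K y : is_subgroup [set x | normal_set K [~ x, y]].
Proof.
have sK := normal_subg K; split => /=.
- by rewrite comm1g; exact: subg1.
- by move=> u v Ku Kv; rewrite commMgJ; apply: subgM => //; exact: normalJ.
- by move=> u Ku; rewrite commVgJ; apply: subgV => //; exact: normalJ.
Qed.

Lemma normalR K x y : normal_set K x -> normal_set K [~ x, y].
Proof.
move=> Kx; rewrite commgEl; have sK := normal_subg K.
by apply: (subgM sK); [exact: subgV | exact: normalJ].
Qed.

Lemma normalRr K x y : normal_set K y -> normal_set K [~ x, y].
Proof.
by move=> Ky; rewrite -invgR; apply: (subgV (normal_subg K)); exact: normalR.
Qed.

Lemma quot_pi_eq1 K x : quot_pi K x = 1 <-> normal_set K x.
Proof.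
have <- : quot_pi K 1 = 1 by exact: (multf1 (quot_pi K)).
split=> [/esym/eq_quotP|Kx].
  by rewrite invg1 mul1g.
by apply/esym/eq_quotP; rewrite invg1 mul1g.
Qed.

Lemma quot_pi_surj K (u : quot K) : exists x, quot_pi K x = u.
Proof. by exists (generic_quotient.repr u); rewrite /quot_pi reprK. Qed.

Lemma normal_modR K x x' y y' :
  normal_set K (x^-1 * y) -> normal_set K (x'^-1 * y') ->
  normal_set K ([~ x, x']^-1 * [~ y, y']).
Proof.
move=> /eq_quotP e /eq_quotP e'; apply/eq_quotP.
have qR u v : quot_pi K [~ u, v] = [~ quot_pi K u, quot_pi K v].
  exact: multfR.
by rewrite -!/(quot_pi K _) in e e' *; rewrite !qR e e'.
Qed.

Lemma normal_modX K x y n :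
  normal_set K (x^-1 * y) -> normal_set K ((x ^+ n)^-1 * y ^+ n).
Proof.
move=> /eq_quotP e; apply/eq_quotP.
have qX u : quot_pi K (u ^+ n) = quot_pi K u ^+ n by exact: multfX.
by rewrite -!/(quot_pi K _) in e *; rewrite !qX e.
Qed.

Lemma normal_modl K x y :
  normal_set K (x^-1 * y) -> normal_set K x <-> normal_set K y.
Proof.
move=> Kxy; have sK := normal_subg K; split=> [Kx|Ky].
  by rewrite -[y](mulVKg x); exact: (subgM sK Kx Kxy).
rewrite -[x]invgK; apply: (subgV sK); rewrite -[x^-1](mulgK y).
exact: (subgM sK Kxy (subgV sK Ky)).
Qed.

Lemma normal_expM K q w n : normal_set K [~ q, w] ->
  normal_set K ((q ^+ n * w ^+ n)^-1 * (q * w) ^+ n).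
Proof.
move=> Kqw; apply/eq_quotP; rewrite -!/(quot_pi K _).
rewrite gmulfM !multfX gmulfM expgMn //.
by apply/commgP/eqP; rewrite -multfR; apply/quot_pi_eq1.
Qed.

Lemma lcsSE i : lcs G i.+2 = commgroup_normal (lcs G i.+1) (setT_normal G).
Proof. by []. Qed.

Lemma lcsR i x y : (1 <= i)%N ->
  normal_set (lcs G i) x -> normal_set (lcs G i.+1) [~ x, y].
Proof.
by case: i => // i _ Lx; rewrite lcsSE; apply: sub_genset; exists x, y.
Qed.

Lemma lcs_ind i A : is_subgroup A ->
  (forall x y, normal_set (lcs G i.+1) x -> A [~ x, y]) -> lcs G i.+2 `<=` A.
Proof.
by move=> sA AL; apply: gen_sub => // z [x [y [Lx _ ->]]]; exact: AL.
Qed.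

Lemma lcs_sub i j : (i <= j)%N -> lcs G j `<=` lcs G i.
Proof.
move=> /subnK <-; elim: (j - i)%N => [//|n IHn] x; rewrite addSn => Lx.
apply: IHn; case: (n + i)%N Lx => [//|m].
by apply: lcs_ind => [|y z Ly]; [exact: normal_subg | exact: normalR].
Qed.

Lemma ucsS K j : ucs K j `<=` ucs K j.+1.
Proof.
elim: j => [x ->|j IHj x [Kx Zx]] /=.
  split=> [|y _]; first exact: subg1 (normal_subg K).
  by rewrite comm1g.
by split=> // y Ky; apply: IHj; exact: Zx.
Qed.

Lemma ucs_mono K i j : (i <= j)%N -> ucs K i `<=` ucs K j.
Proof.
by move=> /subnK <-; elim: (j - i)%N => // n IHn x /IHn; exact: ucsS.
Qed.

End Subgroups.

Section Morphisms.
Variables (G H : groupType) (f : {multiplicative G -> H}).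

Lemma preim_subg (B : set H) : is_subgroup B -> is_subgroup (f @^-1` B).
Proof.
move=> sB; split => /=; first by rewrite multf1; exact: subg1.
- by move=> x y Bx By; rewrite gmulfM; exact: subgM.
- by move=> x Bx; rewrite multfV; exact: subgV.
Qed.

Lemma im_subg (A : set G) : is_subgroup A -> is_subgroup (f @` A).
Proof.
move=> sA; split; first by exists 1; rewrite ?multf1 //; exact: subg1.
- move=> _ _ [x Ax <-] [y Ay <-]; exists (x * y); rewrite ?gmulfM //.
  exact: subgM.
- by move=> _ [x Ax <-]; exists x^-1; rewrite ?multfV //; exact: subgV.
Qed.

Lemma im_gen (A : set G) : f @` gen A `<=` gen (f @` A).
Proof.
move=> _ [x gx <-]; apply: (gx (f @^-1` gen (f @` A))); split.
  exact/preim_subg/gen_subg.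
by move=> y Ay; apply: sub_genset; exists y.
Qed.

Lemma lcs_morph i x : normal_set (lcs G i) x -> normal_set (lcs H i) (f x).
Proof.
case: i x => // i; elim: i => // i IHi.
apply: (@lcs_ind G i (f @^-1` lcs H i.+2)) => [|x y Lx].
  exact/preim_subg/normal_subg.
change (normal_set (lcs H i.+2) (f [~ x, y])).
by rewrite multfR; apply: lcsR => //; exact: IHi.
Qed.

Hypothesis f_surj : forall y, exists x, f x = y.

Lemma lcs_morph_im i : lcs H i `<=` f @` lcs G i.
Proof.
have top y : [set: H] y -> (f @` [set: G]) y.
  by have [x <-] := f_surj y; exists x.
case: i => // i; elim: i => // i IHi.
apply: lcs_ind => [|x y /IHi[x' Lx' <-]]; first exact/im_subg/normal_subg.
have [y' <-] := f_surj y; exists [~ x', y']; last by rewrite multfR.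
exact: lcsR.
Qed.

End Morphisms.

(** * Torsion of the lower central factors *)

Section AbelianTorsion.
Variables (Q : groupType) (B : set Q).
Hypotheses (sB : is_subgroup B) (cB : forall x y, B x -> B y -> commute x y).

(** Collecting powers of [a] leaves an integral exponent; passing to [x^-1] when it is negative
    keeps it in [nat]. *)
Lemma gen_cons_abelian (a : Q) (S : set Q) x :
    B a -> S `<=` B -> gen (a |` S) x ->
  exists c n, gen S c /\ (x = c * a ^+ n \/ x^-1 = c * a ^+ n).
Proof.
move=> Ba SB gx.
have sS := gen_subg S; have gSB : gen S `<=` B by exact: gen_sub.
have Bn n : B (a ^+ n) by exact: subgX.
(* Two natural exponents stand for the integer [n - m], which makes [P] stable under products and
   inverses. *)
pose P x := exists c m n, [/\ B x, gen S c & x * a ^+ m = c * a ^+ n].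
have [c [m [n [Bx Sc e]]]] : P x.
  apply: (gx P); split; last first.
    move=> y [->|Sy].
      exists 1, 0%N, 1%N; rewrite expg0 expg1 mulg1 mul1g.
      by split=> //; exact: subg1.
    exists y, 0%N, 0%N; rewrite expg0; split=> //; first exact: SB.
    exact: sub_genset.
  split.
  - by exists 1, 0%N, 0%N; split; rewrite ?mul1g //; exact: subg1.
  - move=> y z [c [m [n [By Sc e]]]] [d [p [q [Bz Sd f]]]].
    exists (c * d), (m + p)%N, (n + q)%N.
    split; [exact: (subgM sB By Bz) | exact: (subgM sS Sc Sd)|].
    rewrite !expgnDr -!mulgA (mulgA z) (cB Bz (Bn m)) -!mulgA f.
    by rewrite (mulgA y) e -!mulgA (mulgA d) (cB (gSB _ Sd) (Bn n)) -!mulgA.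
  - move=> y [c [m [n [By Sc e]]]].
    exists c^-1, n, m; split; [exact: (subgV sB By) | exact: (subgV sS Sc)|].
    apply: (mulgI c); rewrite mulVKg mulgA.
    rewrite (cB (gSB _ Sc) (subgV sB By)) -mulgA -e.
    by rewrite mulKg.
have Bc := gSB _ Sc.
have [mn|nm] := leqP m n.
  exists c, (n - m)%N; split=> //; left; apply: (mulIg (a ^+ m)).
  by rewrite e -mulgA -expgnDr subnK.
exists c^-1, (m - n)%N; split; first exact: (subgV sS Sc).
right; apply: (mulgI c); rewrite mulVKg (cB Bc (subgV sB Bx)).
apply: (mulgI x); rewrite mulVKg.
by apply: (mulIg (a ^+ n)); rewrite -mulgA -expgnDr subnK // ltnW.
Qed.

Lemma torsion_subg (A : set Q) :
  is_subgroup A -> A `<=` B -> is_subgroup (torsion A).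
Proof.
move=> sA AB; split.
- by split; [exact: subg1 | exists 1%N; rewrite expg1].
- move=> x y [Ax [m [m0 xm]]] [Ay [n [n0 yn]]]; split; first exact: subgM.
  exists (m * n)%N; rewrite muln_gt0 m0; split=> //.
  rewrite expgMn; last by apply: cB; exact: AB.
  by rewrite expgnA xm mulnC expgnA yn !expg1n mulg1.
- move=> x [Ax [m [m0 xm]]]; split; first exact: subgV.
  by exists m; rewrite expVgn xm invg1.
Qed.

(* If some torsion element is c * a ^+ d with c in <S> and d > 0, choose b so
   with d minimal: then every torsion element, or its inverse, is t * b ^+ q
   with t a torsion element of <S>, and b has finite order. *)
Lemma torsion_gen_finite (s : seq Q) :
  [set` s] `<=` B -> finite_set (torsion (gen [set` s])).
Proof.
elim: s => [|a s IHs] sBs.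
  apply: (@sub_finite_set _ _ [set 1]); last exact: finite_set1.
  move=> x [gx _]; apply: (gx [set 1]); split=> //; split=> //=.
  - by move=> ? ? -> ->; rewrite mulg1.
  - by move=> ? ->; rewrite invg1.
pose S := [set` s]; have sS := gen_subg S.
have -> : [set` a :: s] = a |` S.
  apply/seteqP; split=> x /=; rewrite inE.
    by move=> /orP[/eqP|]; [left|right].
  by move=> [->|xs]; rewrite ?eqxx //; apply/orP; right.
have Ba : B a by apply: sBs; rewrite /= inE eqxx.
have SB : S `<=` B by move=> x xs; apply: sBs; rewrite /= inE; apply/orP; right.
have gSB : gen S `<=` B by exact: gen_sub.
have sT := torsion_subg sS gSB.
have gaB : gen (a |` S) `<=` B.
  by apply: gen_sub => // x [->|]//; exact: SB.
have sTa := torsion_subg (gen_subg _) gaB.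
have Sga : gen S `<=` gen (a |` S) by apply: genS => x; right.
have Bn n : B (a ^+ n) by exact: subgX.
pose T := torsion (gen (a |` S)); pose T0 := torsion (gen S).
have fT0 : finite_set T0 by apply: IHs.
suff [F fF TF] : exists2 F, finite_set F &
    forall c n, gen S c -> T (c * a ^+ n) -> F (c * a ^+ n).
  apply: (@sub_finite_set _ _ (F `|` [set x^-1 | x in F])).
    move=> x Tx; have [gx _] := Tx.
    have [c [n [Sc [e|e]]]] := gen_cons_abelian Ba SB gx; [left|right].
      by rewrite e; apply: TF => //; rewrite -e.
    exists (c * a ^+ n); last by rewrite -e invgK.
    by apply: TF => //; rewrite -e; exact: (subgV sTa Tx).
  by rewrite finite_setU; split=> //; exact: finite_image.
pose D d := `[< (0 < d)%N /\ exists2 c, gen S c & T (c * a ^+ d) >].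
have [exD|nD] := pselect (exists d, D d); last first.
  (* No positive exponent occurs here, so only torsion elements of [gen S] remain. *)
  exists T0 => // c n Sc Tcn; case: n Tcn => [|n] Tcn.
    move: Tcn; rewrite expg0 mulg1 => -[_ tc]; by split.
  by case: nD; exists n.+1; apply/asboolP; split=> //; exists c.
case: (ex_minnP exD) => d /asboolP[d0 [c0 Sc0 Tb]] dmin.
set b := c0 * a ^+ d in Tb; have [gb [o [o0 bo]]] := Tb.
have Bb := gaB _ gb.
exists [set t * b ^+ i | t in T0 & i in `I_o].
  by apply: finite_image2 => //; exact: finite_II.
move=> c n Sc Tcn.
pose q := (n %/ d)%N; pose r := (n %% d)%N.
pose t := c * (c0 ^+ q)^-1.
have St : gen S t.
  by apply: (subgM sS) => //; apply: (subgV sS); exact: subgX sS Sc0.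
have e : c * a ^+ n = t * a ^+ r * b ^+ q.
  rewrite /b expgMn; last by apply: cB => //; exact: gSB.
  rewrite -expgnA (mulgA _ (c0 ^+ q)) -(mulgA _ (a ^+ r)).
  rewrite (cB (Bn r) (subgX q sB (gSB _ Sc0))) (mulgA t) mulgVK -mulgA.
  by rewrite -expgnDr addnC mulnC -divn_eq.
have Tr : T (t * a ^+ r).
  have -> : t * a ^+ r = c * a ^+ n * (b ^+ q)^-1 by rewrite e mulgK.
  by apply: (subgM sTa) => //; apply: (subgV sTa); exact: subgX sTa Tb.
have r0 : r = 0%N.
  case E : r => [//|r']; exfalso.
  have : D r by apply/asboolP; rewrite E; split=> //; exists t; rewrite -?E.
  by move/dmin; rewrite leqNgt ltn_pmod.
rewrite r0 expg0 mulg1 in Tr e.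
exists t; first by split=> //; case: Tr.
exists (q %% o)%N; first by rewrite /= ltn_pmod.
by rewrite e {2}(divn_eq q o) expgnDr mulnC expgnA bo expg1n mul1g.
Qed.

End AbelianTorsion.

(** Lagrange for a finite subgroup of an arbitrary group: right translations, carried to ['I_n] by
    the counting bijection, form a permutation group of order [n], to which [expg_cardG] applies. *)
Lemma expg_card_eq (Q : groupType) (A : set Q) n x :
  is_subgroup A -> (A #= `I_n)%card -> A x -> x ^+ n = 1.
Proof.
move=> sA /card_set_bijP[g [gA ginj gsurj]] Ax.
case: n => [|n] in gA gsurj *; first by have := gA _ Ax.
pose f (i : 'I_n.+1) := sval (cid2 (gsurj i (ltn_ord i))).
have fI i : A (f i) by rewrite /f; case: cid2.
have fK i : g (f i) = i by rewrite /f; case: cid2.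
have f_inj : injective f by move=> i j e; apply: val_inj; rewrite /= -!fK e.
have idxP y : A y -> {i : 'I_n.+1 | f i = y}.
  move=> Ay; exists (Ordinal (gA _ Ay)).
  by apply: ginj; rewrite ?inE ?fK.
(* Multiplication is on the right because permutations compose from left to right. *)
pose m (i j : 'I_n.+1) := sval (idxP _ (subgM sA (fI j) (fI i))).
have mE i j : f (m i j) = f j * f i by rewrite /m; exact: (svalP (idxP _ _)).
have m_inj i : injective (m i).
  by move=> j k e; apply/f_inj/(mulIg (f i)); rewrite -!mE e.
pose s i := perm (m_inj i).
have s_inj : injective s.
  move=> i j e; apply/f_inj/(mulgI (f i)).
  by rewrite -!mE; move: (permE (m_inj i) i); rewrite -/(s i) e permE => ->.
have sM i j k : f k = f i * f j -> s i * s j = s k.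
  move=> e; apply/permP => l; rewrite permM !permE; apply: f_inj.
  by rewrite !mE e mulgA.
have gR : group_set [set s i | i in 'I_n.+1].
  apply/group_setP; split.
    have [i fi] := idxP _ (subg1 sA); apply/imsetP; exists i => //.
    apply/permP => j; rewrite perm1 permE; apply: f_inj.
    by rewrite mE fi mulg1.
  move=> _ _ /imsetP[i _ ->] /imsetP[j _ ->].
  have [k fk] := idxP _ (subgM sA (fI i) (fI j)).
  by apply/imsetP; exists k => //; exact: sM.
have [i fi] := idxP _ Ax.
have cR : #|Group gR| = n.+1 by rewrite card_imset // card_ord.
have sR : s i \in Group gR by apply/imsetP; exists i.
have := expg_cardG sR; rewrite cR => si1.
have sX k j : f ((s i ^+ k) j) = f j * x ^+ k.
  elim: k j => [|k IHk] j; first by rewrite perm1 expg0 mulg1.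
  by rewrite expgS permM IHk permE mE fi expgS mulgA.
by have := sX n.+1 i; rewrite si1 perm1 -{1}[f i]mulg1 => /mulgI.
Qed.

(** Commutators are bilinear modulo the next term, so those of generators of one factor with
    generators of [G] generate the next factor. *)
Lemma lcs_fg_mod (G : groupType) i : finitely_generated G -> (1 <= i)%N ->
  exists S : set G, [/\ finite_set S, S `<=` lcs G i &
                        lcs G i `<=` gen (S `|` lcs G i.+1)].
Proof.
case: i => // i [X [fX genX]] _; elim: i => [|i [S [fS SL LS]]].
  exists X; split=> // x _; have : gen X x by rewrite genX.
  by apply: genS => y; left.
pose S' := [set [~ a, b] | a in S & b in X].
have S'L : S' `<=` lcs G i.+2.
  by move=> _ [a Sa [b _ <-]]; apply: lcsR => //; exact: SL.
have WL : gen (S' `|` lcs G i.+3) `<=` lcs G i.+2.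
  apply: gen_sub; first exact: normal_subg.
  by move=> x [/S'L//|]; apply: lcs_sub.
have LW : lcs G i.+3 `<=` gen (S' `|` lcs G i.+3).
  by move=> x Lx; apply: sub_genset; right.
(* [G] acts trivially on the factor containing the image of this subgroup. Normality lets
   [comm_in_subg] reduce both arguments of a commutator to generators. *)
have WJ : conj_closed (gen (S' `|` lcs G i.+3)).
  move=> w z Ww; rewrite -[w ^ z](mulVKg w) -commgEl.
  by apply: (subgM (gen_subg _)) => //; apply: LW; apply: lcsR => //; exact: WL.
pose W := Normal (gen_subg _) WJ.
exists S'; split=> //; first exact: finite_image2.
apply: (@lcs_ind _ i W) => [|x y Lx]; first exact: gen_subg.
move: (LS _ Lx); apply: (@gen_sub _ _ [set x | normal_set W [~ x, y]]).
  exact: comm_in_subg.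
move=> a [Sa|La] /=; last by apply: LW; exact: lcsR.
rewrite -invgR; apply: (subgV (gen_subg _)).
have : gen X y by rewrite genX.
apply: (@gen_sub _ _ [set x | normal_set W [~ x, a]]).
  exact: comm_in_subg.
move=> b Xb /=; rewrite -invgR; apply: (subgV (gen_subg _)).
by apply: sub_genset; left; exists a => //; exists b.
Qed.

Lemma lcs_factor_torsion_finite (G : groupType) i :
  finitely_generated G -> (1 <= i)%N -> finite_set (torsion (lcs_factor G i)).
Proof.
move=> fgG i1; have [S [/finite_seqP[s ->] SL LS]] := lcs_fg_mod fgG i1.
set f := quot_pi (lcs G i.+1).
have sF : is_subgroup (lcs_factor G i).
  exact/(im_subg f)/normal_subg.
apply: (@sub_finite_set _ _ (torsion (gen [set` map f s]))); last first.
  apply: (@torsion_gen_finite _ (lcs_factor G i)) => //.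
    move=> _ _ [x Lx <-] [y Ly <-]; apply/commgP/eqP.
    by rewrite -multfR; apply/quot_pi_eq1; exact: lcsR.
  by move=> _ /mapP[x xs ->]; exists x => //; exact: SL.
move=> _ [[x Lx <-] tx]; split=> //; rewrite -/f in tx *.
have := im_gen (f := f) (ex_intro2 _ _ x (LS x Lx) erefl).
apply: gen_sub; first exact: gen_subg.
move=> _ [y [ys|Ly] <-]; first by apply: sub_genset; exact: map_f.
have fy1 : f y = 1 by apply/quot_pi_eq1.
by rewrite [X in gen _ X]fy1; exact: subg1 (gen_subg _).
Qed.

Lemma expg_coprime_eq1 (Q : groupType) (x : Q) m n :
  (0 < m)%N -> coprime m n -> x ^+ m = 1 -> x ^+ n = 1 -> x = 1.
Proof.
move=> m0 /(coprimeP _ m0)[[u v] /= uv] xm xn.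
have e : (u * m = 1 + v * n)%N.
  by rewrite -uv subnK //; rewrite ltnW // -subn_gt0 uv.
have := congr1 (fun k => x ^+ k) e.
by rewrite mulnC expgnA xm expg1n expgnDr expg1 mulnC expgnA xn expg1n mulg1.
Qed.

(** The torsion of the factor is finite, so its order [m] has all its prime divisors in [tau G],
    hence in [t]. Thus [n] is coprime to [m], and both kill the class of [x]. *)
Lemma lcs_root (G : groupType) (t : set nat) i n x :
  finitely_generated G -> tau G `<=` t -> (1 <= i)%N ->
  pi_number (prime_compl t) n -> normal_set (lcs G i) x ->
  normal_set (lcs G i.+1) (x ^+ n) -> normal_set (lcs G i.+1) x.
Proof.
move=> fgG tt i1 [n0 nt] Lx Lxn.
set f := quot_pi (lcs G i.+1).
have Tx : torsion (lcs_factor G i) (f x).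
  split; first by exists x.
  by exists n; split=> //; rewrite -multfX; apply/quot_pi_eq1.
have /finite_setP[m Tm] := lcs_factor_torsion_finite fgG i1.
have sF : is_subgroup (lcs_factor G i).
  exact/(im_subg f)/normal_subg.
have sT : is_subgroup (torsion (lcs_factor G i)).
  apply: (@torsion_subg _ (lcs_factor G i)) => //.
  move=> _ _ [y Ly <-] [z Lz <-]; apply/commgP/eqP.
  by rewrite -multfR; apply/quot_pi_eq1; exact: lcsR.
have xm := expg_card_eq sT Tm Tx.
have cop : coprime n m.
  have [m0|m0] := posnP m.
    by move: Tm; rewrite m0 II0 card_eq0 => /eqP T0; rewrite T0 in Tx.
  rewrite coprime_has_primes //; apply/hasPn => p pm; apply/negP => pn.
  have [_] := nt p pn; apply; apply: tt; exists i => //.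
  by exists m.
apply/quot_pi_eq1/(expg_coprime_eq1 n0 cop) => //.
by have [_ [? _]] := Tx; rewrite -multfX; apply/quot_pi_eq1.
Qed.

(** * Lower central monomorphisms *)

Section QuotientMap.
Variables (G H : groupType) (f : {multiplicative G -> H}).
Variables (N : normal G) (K : normal H).

Lemma quot_map_exists : (forall x, normal_set N x -> normal_set K (f x)) ->
  exists g : {multiplicative (quot N) -> (quot K)},
    forall x, g (quot_pi N x) = quot_pi K (f x).
Proof.
move=> NK; pose F (u : quot N) := quot_pi K (f (generic_quotient.repr u)).
have FE x : F (quot_pi N x) = quot_pi K (f x).
  apply/eq_quotP; rewrite -multfV -gmulfM; apply: NK.
  by apply/eq_quotP; rewrite generic_quotient.reprK.
have FM : {morph F : x y / x * y}.
  move=> u v; have [x <-] := quot_pi_surj u; have [y <-] := quot_pi_surj v.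
  by rewrite -gmulfM !FE !gmulfM.
pose M := isMultiplicative.Build _ _ F FM.
pose g : {multiplicative (quot N) -> (quot K)} := HB.pack F M.
by exists g.
Qed.

(** This allows later arguments to work with elements of [G] and [H] instead of maps between
    quotients. *)
Lemma induces_isoP : induces_iso f N K <->
  (forall x, normal_set N x <-> normal_set K (f x)) /\
  (forall y, exists x, normal_set K ((f x)^-1 * y)).
Proof.
split=> [[g [[g' gK g'K] gE]]|[NK surj]].
  split=> [x|y].
    split=> [/quot_pi_eq1 Nx|/quot_pi_eq1 Kx].
      by apply/quot_pi_eq1; rewrite -gE Nx multf1.
    by apply/quot_pi_eq1; apply: (can_inj gK); rewrite gE Kx multf1.
  have [x e] := quot_pi_surj (g' (quot_pi K y)).
  by exists x; apply/eq_quotP; rewrite -/(quot_pi K _) -gE e g'K.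
have [g gE] := quot_map_exists (fun x => (NK x).1).
exists g; split=> //.
have surj' v : exists u, g u = v.
  have [y <-] := quot_pi_surj v; have [x Kx] := surj y.
  by exists (quot_pi N x); rewrite gE; apply/eq_quotP.
apply: (@Bijective _ _ g (fun v => sval (cid (surj' v)))) => [u|v]; last first.
  exact: (svalP (cid (surj' v))).
have := svalP (cid (surj' (g u))); move: (sval _) => u'.
have [x <-] := quot_pi_surj u; have [x' <-] := quot_pi_surj u'.
rewrite !gE => /eq_quotP Kx; apply/eq_quotP/NK.
by rewrite gmulfM multfV.
Qed.

End QuotientMap.

Lemma commg_mul_central (Q : groupType) (a b u v : Q) :
  (forall z, commute u z) -> (forall z, commute v z) ->
  [~ a * u, b * v] = [~ a, b].
Proof.
move=> cu cv.
have cc (w x y : Q) : (forall z, commute w z) -> [~ x * w, y] = [~ x, y].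
  move=> cw; rewrite commMgJ (_ : [~ w, y] = 1) ?mulg1; last exact/eqP/commgP.
  by apply/conjg_fixP/commgP/commute_sym.
by rewrite cc // -invgR cc // invgR.
Qed.

Section LowerCentral.
Variables (G H : groupType) (f : {multiplicative G -> H}).
Hypothesis f_ab : forall y, exists x, normal_set (lcs H 2) ((f x)^-1 * y).

(** The two claims support each other: approximating both arguments of a commutator in [H] gives
    errors that are central modulo the next term and so do not change the commutator there. *)
Lemma lcs_approx_aux i :
  (forall y, exists x, normal_set (lcs H i.+2) ((f x)^-1 * y)) /\
  (forall y, normal_set (lcs H i.+1) y ->
   exists2 x, normal_set (lcs G i.+1) x &
              normal_set (lcs H i.+2) ((f x)^-1 * y)).
Proof.
elim: i => [|i [IHtop IHi]].
  by split=> // y _; have [x] := f_ab y; exists x.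
have step y : normal_set (lcs H i.+2) y ->
   exists2 x, normal_set (lcs G i.+2) x &
              normal_set (lcs H i.+3) ((f x)^-1 * y).
  pose A := f @` lcs G i.+2.
  suff sub : lcs H i.+2 `<=`
      [set z | exists2 w, A w & normal_set (lcs H i.+3) (w^-1 * z)].
    by move=> /sub[_ [x Lx <-]]; exists x.
  apply: lcs_ind => [|x z /IHi[a La Lu]].
    exact/mulset_subg/im_subg/normal_subg.
  have [b Lv] := IHtop z.
  exists (f [~ a, b]); first by exists [~ a, b] => //; exact: lcsR.
  apply/eq_quotP; rewrite -!/(quot_pi (lcs H i.+3) _).
  have central w : normal_set (lcs H i.+2) w ->
      forall q, commute (quot_pi (lcs H i.+3) w) q.
    move=> Lw q; have [c <-] := quot_pi_surj q; apply/commgP/eqP.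
    by rewrite -multfR; apply/quot_pi_eq1/lcsR.
  have [u ux] : exists u, x = f a * u by exists ((f a)^-1 * x); rewrite mulVKg.
  have [v vz] : exists v, z = f b * v by exists ((f b)^-1 * z); rewrite mulVKg.
  rewrite ux vz !mulKg in Lu Lv *; rewrite !multfR !gmulfM.
  by rewrite commg_mul_central //; exact: central.
split; last exact: step.
(* The error left by [a] is itself approximated by [f b], one level deeper. *)
move=> y; have [a La] := IHtop y; have [b Lb Lab] := step _ La.
by exists (a * b); rewrite gmulfM invgM -mulgA.
Qed.

Lemma lcs_approx i y : exists x, normal_set (lcs H i) ((f x)^-1 * y).
Proof.
have [/(_ y) [x Lx] _] := lcs_approx_aux i; exists x.
by apply: lcs_sub Lx; rewrite ltnW.
Qed.

End LowerCentral.

(** A set [t] containing [tau G] is allowed because the lemma also serves for the quotient by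
    [Z_j(M)], with [t] still the tau of the original group. *)
Lemma lower_central_mono_iso (t : set nat) (G H : groupType)
    (f : {multiplicative G -> H}) :
  finitely_generated G -> tau G `<=` t -> lower_central_mono t f ->
  forall i, (1 <= i)%N -> induces_iso f (lcs G i) (lcs H i).
Proof.
move=> fgG tt [f_inj /induces_isoP[_ f_ab] [n nP]] i i1.
apply/induces_isoP; split; last by move=> y; exact: lcs_approx.
case: i i1 => // i _ x; split; first exact: lcs_morph.
elim: i => [//|i IHi] Lfx.
have Lx : normal_set (lcs G i.+1) x by apply: IHi; apply: lcs_sub Lfx.
(* The power of [f x] is the image of an element of [lcs G i.+2]; by injectivity that element is the
   power of [x], and [lcs_root] extracts the root. *)
have [pin pown] := nP i.+2 isT.
apply: (lcs_root (t := t) (n := n i.+2)) => //.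
have [|z Lz /f_inj <-//] := pown (f (x ^+ n i.+2)).
by rewrite multfX; apply: sub_genset; exists (f x).
Qed.

(** * Isolators and upper central series *)

Lemma pi_number1 (s : set nat) : pi_number s 1.
Proof. by split=> // p. Qed.

Lemma pi_numberM (s : set nat) m n :
  pi_number s m -> pi_number s n -> pi_number s (m * n).
Proof.
move=> [m0 sm] [n0 sn]; split=> [|p /=]; first by rewrite muln_gt0 m0.
by rewrite [_ \in _]primesM // => /orP[/sm|/sn].
Qed.

Lemma sub_isolator (G : groupType) (pi : set nat) (K : set G) :
  K `<=` isolator pi K.
Proof.
move=> x Kx; apply: sub_genset; exists 1%N; rewrite expg1.
by split=> //; exact: pi_number1.
Qed.

Lemma quot_fg (G : groupType) (K : normal G) :
  finitely_generated G -> finitely_generated (quot K).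
Proof.
move=> [A [fA gA]]; exists (quot_pi K @` A); split; first exact: finite_image.
apply/seteqP; split=> // u _; have [x <-] := quot_pi_surj u.
by apply: im_gen; exists x => //; rewrite gA.
Qed.

(* Let Z_i denote [ucs N i], and let z be in Z_(j+1).  Write z = x h as in the
   hypothesis: x and h commute modulo Z_j, so a power of z lies in [Q] Z_j.
   If a power of z is q w with w in Z_(i+1), then q and w commute modulo Z_i and
   by induction on j a power of w lies in [Q], so a power of z lies in [Q] Z_i. *)
Lemma ucs_power_mem (H : groupType) (N : normal H) (Q : set H) (s : set nat) :
  is_subgroup Q ->
  (forall z, normal_set N z -> exists x h n,
     [/\ Q x, normal_set N h, z = x * h, pi_number s n & Q (h ^+ n)]) ->
  forall j z, ucs N j z -> exists2 m, pi_number s m & Q (z ^+ m).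
Proof.
move=> sQ NQ; have sN := normal_subg N; elim=> [z ->|j IHj z Zz].
  by exists 1%N; [exact: pi_number1 | rewrite expg1; exact: subg1].
have [Nz zC] := Zz.
suff descend i : (i <= j)%N -> exists m q w,
    [/\ pi_number s m, Q q, ucs N (j - i) w & z ^+ m = q * w].
  have [m [q [w [sm Qq]]]] := descend j (leqnn j).
  rewrite subnn => -> zm; exists m => //; rewrite zm.
  by apply: (subgM sQ) => //; exact: subg1.
elim: i => [_|i IHi ij].
  have [x [h [n [Qx Nh zE sn Qh]]]] := NQ z Nz.
  (* [z] is central in [N] modulo [Z_j], so [x = z * h^-1] commutes with [h] there. *)
  have Zxh : ucs N j [~ x, h].
    have -> : x = z * h^-1 by rewrite zE mulgK.
    rewrite commMgJ commVgJ commgg conj1g invg1 mulg1.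
    by apply: ucs_conj; exact: zC.
  exists n, (x ^+ n * h ^+ n), ((x ^+ n * h ^+ n)^-1 * z ^+ n).
  rewrite subn0 mulVKg; split=> //.
    by apply: (subgM sQ) => //; exact: subgX.
  by rewrite zE; exact: (@normal_expM _ (ucs_normal N j)).
have [m [q [w [sm Qq Zw zm]]]] := IHi (ltnW ij).
have [m' sm' Qw] := IHj w (ucs_mono (leq_subr i j) Zw).
rewrite -subSS subSn // in Zw; have [Nw wC] := Zw.
(* [w] is central only within [N], so commuting with [q] requires [q] in [N]. *)
have Nq : normal_set N q.
  have -> : q = z ^+ m * w^-1 by rewrite zm mulgK.
  by apply: (subgM sN); [exact: subgX | exact: subgV].
exists (m * m')%N, (q ^+ m' * w ^+ m').
exists ((q ^+ m' * w ^+ m')^-1 * (q * w) ^+ m').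
split; first exact: pi_numberM.
- by apply: (subgM sQ) => //; exact: subgX.
- apply: (@normal_expM _ (ucs_normal N (j - i.+1))).
  by rewrite -invgR; apply: (subgV (ucs_subg _ _)); exact: wC.
- by rewrite mulVKg expgnA zm.
Qed.

(** For [j = 0] every approximant is [1] and residual nilpotence concludes. For the step, if [z]
    approximates [y], then [[~ z, n]] approximates [[~ y, n]] one level lower in the upper central
    series. *)
Lemma ucs_closed (H : groupType) (N : normal H) j y :
  residually_nilpotent H -> normal_set N y ->
  (forall l, exists2 z, ucs N j z & normal_set (lcs H l) (z^-1 * y)) ->
  ucs N j y.
Proof.
move=> rnH; elim: j y => [|j IHj] y Ny Zy.
  have : (\bigcap_(i in [set i | (1 <= i)%N]) lcs H i) y.
    by move=> l _; have [z ->] := Zy l; rewrite invg1 mul1g.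
  by rewrite rnH.
split=> // n Nn; apply: IHj => [|l]; first exact: normalRr.
have [z [Nz zC] Lu] := Zy l; exists [~ z, n]; first exact: zC.
apply: normal_modR => //; rewrite mulVg; exact: subg1 (normal_subg _).
Qed.

Section Transfer.
Variables (G H : groupType) (f : {multiplicative G -> H}).
Hypothesis rnH : residually_nilpotent H.
Hypothesis f_inj : injective f.
Hypothesis lcsE : forall i x, (1 <= i)%N ->
  normal_set (lcs G i) x <-> normal_set (lcs H i) (f x).
Hypothesis f_approx : forall i y, exists x, normal_set (lcs H i) ((f x)^-1 * y).

Variables (pi : set nat) (k : nat).
Hypothesis k_ge1 : (1 <= k)%N.
Let N : normal H := isolator_normal pi (lcs H k).
Let M : normal G := isolator_normal pi (lcs G k).

(** Conversely, a generator of [N] is congruent modulo [lcs H k] to some [f x'], and so are their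
    powers, which puts [x'] in [M]. Hence [N] lies in [f(M)] times [lcs H k], and [lcs G k] lies in
    [M]. *)
Lemma isolator_lcsE x : normal_set M x <-> normal_set N (f x).
Proof.
split.
  apply: (@gen_sub _ _ (f @^-1` isolator pi (lcs H k))).
    exact/preim_subg/gen_subg.
  move=> y [n [pin Ly]]; apply: sub_genset; exists n; split=> //.
  by rewrite -multfX; apply/lcsE.
have sM := normal_subg M.
suff sub : normal_set N `<=`
    [set y | exists2 w, (f @` normal_set M) w &
                        normal_set (lcs H k) (w^-1 * y)].
  move=> /sub[_ [m Mm <-]]; rewrite -multfV -gmulfM => /(lcsE _ k_ge1).2 Lx.
  rewrite -[x](mulVKg m); apply: (subgM sM) => //; exact: sub_isolator.
apply: gen_sub; first exact/mulset_subg/im_subg.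
move=> y [n [pin Ly]]; have [x' Lx'] := f_approx k y.
exists (f x') => //; exists x' => //; apply: sub_genset; exists n; split=> //.
by apply/lcsE => //; rewrite multfX; apply/(normal_modl (normal_modX n Lx')).
Qed.

Lemma isolator_lcs_approx l y : normal_set N y ->
  exists2 x, normal_set M x & normal_set (lcs H l) ((f x)^-1 * y).
Proof.
(* Level [k] keeps [f x] in [N]; level [l] gives the required precision. *)
move=> Ny; have [x Lx] := f_approx (maxn k l) y.
exists x; last by apply: lcs_sub Lx; exact: leq_maxr.
apply/isolator_lcsE.
have Nu : normal_set N ((f x)^-1 * y).
  by apply: sub_isolator; apply: lcs_sub Lx; exact: leq_maxl.
exact/(normal_modl Nu).
Qed.

Lemma ucs_isolatorE j x : ucs M j x <-> ucs N j (f x).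
Proof.
elim: j x => [|j IHj] x /=.
  by split=> [->|]; [exact: multf1 | rewrite -(multf1 f) => /f_inj].
split=> [[Mx xC]|[Nx xC]]; split; try exact/isolator_lcsE.
  (* Centrality is known only against [f(M)]; approximating [n] by elements of [f(M)] and closedness
     extend it to all of [N]. *)
  move=> n Nn; apply: (@ucs_closed H N) => // [|l]; first exact: normalRr.
  have [m Mm Lu] := isolator_lcs_approx l Nn.
  exists [~ f x, f m]; first by rewrite -multfR; apply/IHj/xC.
  apply: normal_modR => //; rewrite mulVg; exact: subg1 (normal_subg _).
by move=> y My; apply/IHj; rewrite multfR; apply: xC; apply/isolator_lcsE.
Qed.

End Transfer.

(** * The induced map of quotients *)

Section LowerCentralMono.
Variables (G H : groupType) (f : {multiplicative G -> H}).
Hypotheses (fgG : finitely_generated G) (rnH : residually_nilpotent H).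
Hypothesis f_lc : lower_central_mono (tau G) f.
Variables (pi : set nat) (k j : nat).
Hypothesis k_ge1 : (1 <= k)%N.
Let N : normal H := isolator_normal pi (lcs H k).
Let M : normal G := isolator_normal pi (lcs G k).
Let Nj := ucs_normal N j.
Let Mj := ucs_normal M j.

Let f_inj : injective f. Proof. by have [] := f_lc. Qed.

Let f_lcs i x : (1 <= i)%N ->
  normal_set (lcs G i) x <-> normal_set (lcs H i) (f x).
Proof.
move=> i1.
have := lower_central_mono_iso fgG (@subset_refl _ _) f_lc i1.
by move=> /induces_isoP[].
Qed.

Let f_approx i y : exists x, normal_set (lcs H i) ((f x)^-1 * y).
Proof. by apply: lcs_approx; have [_ /induces_isoP[]] := f_lc. Qed.

Let f_ucs x : normal_set Mj x <-> normal_set Nj (f x).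
Proof. exact: ucs_isolatorE. Qed.

Lemma ucs_isolator_root z : ucs N j z ->
  exists2 m, pi_number (prime_compl (tau G)) m & exists x, z ^+ m = f x.
Proof.
move=> Zz; have [_ _ [n nP]] := f_lc.
have [|y Ny|m pim [x _ zm]] :=
    @ucs_power_mem _ N (f @` [set: G]) (prime_compl (tau G)) _ _ j z Zz.
- exact/im_subg/setT_subg.
(* [lcs H i] must lie in [N], and the exponents are given only from index 2 on. *)
- pose i := maxn k 2; have [pin pown] := nP i (leq_maxr k 2).
  have [x Lx] := f_approx i y.
  exists (f x), ((f x)^-1 * y), (n i); rewrite mulVKg; split=> //.
  + by apply: sub_isolator; apply: lcs_sub Lx; exact: leq_maxl.
  + have [|g _ <-] := pown (((f x)^-1 * y) ^+ n i); last by exists g.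
    by apply: sub_genset; exists ((f x)^-1 * y).
- by exists m => //; exists x.
Qed.

Lemma lower_central_mono_quot (g : {multiplicative (quot Mj) -> (quot Nj)}) :
  (forall x, g (quot_pi Mj x) = quot_pi Nj (f x)) ->
  tau (quot Mj) `<=` tau G -> lower_central_mono (tau G) g.
Proof.
move=> gE tauM; split.
- move=> u v; have [x <-] := quot_pi_surj u; have [y <-] := quot_pi_surj v.
  rewrite !gE => /eq_quotP; rewrite -multfV -gmulfM => /f_ucs Mxy.
  exact/eq_quotP.
- apply/induces_isoP; split=> [u|v]; last first.
    have [y <-] := quot_pi_surj v; have [x Lx] := f_approx 2 y.
    exists (quot_pi Mj x); rewrite gE -multfV -gmulfM.
    exact: lcs_morph.
  split; first exact: lcs_morph.
  have [x <-] := quot_pi_surj u; rewrite gE => Lgu.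
  (* Here [z = h^-1 * f x] lies in [Z_j(N)] and is congruent to [f x] modulo [lcs H 2]. *)
  have [h Lh /eq_quotP Zz] := lcs_morph_im (@quot_pi_surj _ Nj) Lgu.
  have [m pim [y zm]] := ucs_isolator_root Zz.
  have My : normal_set Mj y.
    by apply/f_ucs; rewrite -zm; exact: subgX (normal_subg Nj) Zz.
  apply: (lcs_root (i := 1) (n := m)) tauM _ pim _ _ => //.
    exact: quot_fg.
  (* As [y] is trivial in the quotient, this makes the [m]-th power of the class of [x] a member of
     the derived subgroup. *)
  have Ly : normal_set (lcs G 2) (y^-1 * x ^+ m).
    apply/f_lcs => //; rewrite gmulfM multfV -zm multfX.
    apply: normal_modX; rewrite invgM invgK -mulgA.
    exact: normalJ.
  have -> : quot_pi Mj x ^+ m = quot_pi Mj (y^-1 * x ^+ m).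
    rewrite -multfX; apply/esym/eq_quotP; rewrite invgM invgK -mulgA.
    exact: normalJ.
  exact: lcs_morph.
(* The same exponents work, since lower central terms of the quotient of [H] lift to those of
   [H]. *)
- have [_ _ [n nP]] := f_lc; exists n => i i2; have [pin pown] := nP i i2.
  split=> //; apply: gen_sub; first exact/im_subg/normal_subg.
  move=> _ [v Lv <-].
  have [h Lh <-] := lcs_morph_im (@quot_pi_surj _ Nj) Lv.
  have [|x Lx fx] := pown (h ^+ n i); first by apply: sub_genset; exists h.
  exists (quot_pi Mj x); first exact: lcs_morph.
  by rewrite gE fx multfX.
Qed.

Lemma para_quot_ucs_isolator :
  tau (quot Mj) `<=` tau G -> para (quot Mj) (quot Nj).
Proof.
move=> tauM; have [g gE] := quot_map_exists (fun x => (f_ucs x).1).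
have g_lc := lower_central_mono_quot gE tauM.
exists g; split=> [|i i1]; first by have [] := g_lc.
by apply: (lower_central_mono_iso (t := tau G)) => //; exact: quot_fg.
Qed.

End LowerCentralMono.

(** An isomorphism satisfies the hypotheses of [ucs_isolatorE] as well, with exact preimages as
    approximants, so it matches the two subgroups being factored out. *)
Lemma isomorphic_quot_ucs_isolator (G H : groupType) (pi : set nat)
    (k j : nat) :
  residually_nilpotent H -> (1 <= k)%N -> isomorphic G H ->
  isomorphic (quot (ucs_normal (isolator_normal pi (lcs G k)) j))
             (quot (ucs_normal (isolator_normal pi (lcs H k)) j)).
Proof.
move=> rnH k1 [f [g fK gK]].
have fI : injective f := can_inj fK.
have surj y : exists x, f x = y by exists (g y).
have f_lcs i x : (1 <= i)%N ->
    normal_set (lcs G i) x <-> normal_set (lcs H i) (f x).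
  move=> _; split; first exact: lcs_morph.
  by move=> /(lcs_morph_im surj)[x' Lx' /fI <-].
have f_approx i y : exists x, normal_set (lcs H i) ((f x)^-1 * y).
  by exists (g y); rewrite gK mulVg; exact: subg1 (normal_subg _).
have [h [h_bij _]] : induces_iso f (ucs_normal (isolator_normal pi (lcs G k)) j)
                            (ucs_normal (isolator_normal pi (lcs H k)) j).
  apply/induces_isoP; split=> [x|y].
    exact: (ucs_isolatorE rnH fI f_lcs f_approx).
  by exists (g y); rewrite gK mulVg; exact: subg1 (normal_subg _).
by exists h.
Qed.

Theorem proposition2p6 (G H : groupType)
    (fgG : finitely_generated G) (fgH : finitely_generated H)
    (rnG : residually_nilpotent G) (rnH : residually_nilpotent H)
    (tau_fin : finite_set (tau G))
    (phi : {multiplicative G -> H})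
    (phi_lc : lower_central_mono (tau G) phi)
    (k : nat) (k_ge1 : (1 <= k)%N)
    (pi : set nat) (pi_tau : pi `<=` tau G) :
  let N : normal H := isolator_normal pi (lcs H k) in
  let M : normal G := isolator_normal pi (lcs G k) in
  forall j : nat, (1 <= j)%N ->
    tau (quot (ucs_normal M j)) `<=` tau G ->
    para (quot (ucs_normal M j)) (quot (ucs_normal N j)) /\
    (~ isomorphic (quot (ucs_normal M j)) (quot (ucs_normal N j)) ->
     ~ isomorphic G H).
Proof.
move=> N M j _ tauM; split.
  exact: (para_quot_ucs_isolator fgG rnH phi_lc).
by move=> nMN GH; apply: nMN; exact: isomorphic_quot_ucs_isolator.
Qed.
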